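(* Let $k\ge 2$ be an integer and put $M(3,k)=1+3+3^2+\dots+3^k$. Suppose that (i) $k\equiv 3$ or $5 \pmod 6$, (ii) $k+2$ does not divide $\frac{M(3,k)-k-1}{2}$, and (iii) $M(3,k)+1$ is prime. Then there is no $(3,k;+1)$-digraph.
   Context: Digraphs are finite and without multiple arcs. A digraph $G$ is $k$-geodetic if for any (not necessarily distinct) vertices $u,v$ there is at most one directed walk from $u$ to $v$ of length at most $k$ (walks of length $0$ count, so there are no directed cycles of length at most $k$). A $(d,k;+1)$-digraph is a $k$-geodetic digraph with minimum out-degree $d$ and order $M(d,k)+1$, where $M(d,k)=1+d+d^2+\dots+d^k$. It is known that every $(d,k;+1)$-digraph with $d,k\ge 2$ is diregular (all in-degrees and out-degrees equal $d$). *)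

(* Defs.v *)
From mathcomp Require Import all_boot.

Set Implicit Arguments.
Unset Strict Implicit.
Unset Printing Implicit Defensive.

(* A finite digraph without multiple arcs is a relation [e : rel T] on a
   [finType], [e u v] meaning that there is an arc from [u] to [v].  Loops are
   not excluded here; [k]-geodecity excludes them as soon as [0 < k]. *)

(* The walk u = x_0 -> x_1 -> ... -> x_l = v is encoded by the sequence
   p = [:: x_1; ...; x_l]; its length is [size p], and the walk of length 0
   at [u] is [::]. *)
Definition walk (T : finType) (e : rel T) (u v : T) (p : seq T) : bool :=
  path e u p && (last u p == v).

Definition geodetic (T : finType) (e : rel T) (k : nat) : Prop :=
  forall (u v : T) (p q : seq T),
    walk e u v p -> size p <= k ->
    walk e u v q -> size q <= k ->
    p = q.

Definition outdeg (T : finType) (e : rel T) (u : T) : nat :=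
  #|[set v | e u v]|.

Definition has_min_outdeg (T : finType) (e : rel T) (d : nat) : Prop :=
  (forall u : T, d <= outdeg e u) /\ (exists u : T, outdeg e u = d).

Definition moore (d k : nat) : nat := \sum_(i < k.+1) d ^ i.

Definition excess_one_digraph (d k : nat) (T : finType) (e : rel T) : Prop :=
  [/\ geodetic e k, has_min_outdeg e d & #|T| = moore d k + 1].

(* Main.v *)
(* Write [A] for the adjacency matrix.  Counting walks shows that the digraph is
   3-out-regular and that [I + A + ... + A^k = J - P], where [P] is the matrix of
   the map [o] sending a vertex to the only vertex it does not reach.

   Primality of [moore 3 k + 1 = (3^(k+1) + 1) / 2] forces [k + 1] to be a power
   of 2; the congruence on [k] then reads [k = 3 mod 6] and makes it a power of 4.

   If some in-degree exceeds 3, then all rows of [A^(k+2) - A] are equal, so there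
   are [3^(2k+1) - 3^k] closed walks of length [2k + 1].  None of them is periodic,
   hence [2k + 1] divides this number, which is impossible modulo a prime
   [q = 3 mod 4] dividing [2k + 1].

   Otherwise [o] is an automorphism without fixed points, and the vertices fixed
   by a power of [o] again form a digraph of excess one, of degree 0 (two
   vertices), 1 (a cycle of length [k + 2]) or 3; degree 2 is excluded.  So [o] has
   at most one 2-cycle and at most one [(k + 2)]-cycle, and all its other cycles
   have the same length, a multiple of these.  If both are present, [k + 2] divides
   [moore 3 k - 1], which is impossible modulo a prime [q = 2 mod 3] dividing
   [k + 2]; if exactly one is, the order of the digraph is not an odd prime; if
   none is, the digraph is circulant and [a + b = b + a] gives two walks of
   length 2. *)
Require Import Defs.
From mathcomp Require Import all_boot.
From mathcomp Require Import zify.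

Set Implicit Arguments.
Unset Strict Implicit.
Unset Printing Implicit Defensive.

(** * Counting walks *)

Section Walks.

Variables (T : finType) (e : rel T).

(** The entry of A^i at (u, v), for A the adjacency matrix; [nwalks_le j] is then I + A + ... + A^j.
    Recursion on the first arc keeps matrix identities as sums of naturals. *)
Fixpoint nwalks (i : nat) (u v : T) : nat :=
  if i is j.+1 then \sum_(w | e u w) nwalks j w v else u == v.

Definition nwalks_le (j : nat) (u v : T) : nat := \sum_(i < j.+1) nwalks i u v.

Definition indeg (v : T) : nat := #|[set u | e u v]|.

Lemma outdegE u : \sum_(w | e u w) 1 = outdeg e u.
Proof. by rewrite sum1_card /outdeg cardsE. Qed.

Lemma indegE v : \sum_(w | e w v) 1 = indeg v.
Proof. by rewrite sum1_card /indeg cardsE. Qed.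

Lemma sum_eq1 (F : T -> nat) v : \sum_w (w == v) * F w = F v.
Proof.
rewrite (bigD1 v) //= eqxx mul1n big1 ?addn0 // => w /negPf ->.
by rewrite mul0n.
Qed.

Lemma sum_pred1 (v : T) : \sum_(w : T) (w == v) = 1.
Proof. by rewrite -[RHS](sum_eq1 (fun=> 1) v); apply: eq_bigr => w _; rewrite muln1. Qed.

Lemma sum_mulb (P : pred T) (F : T -> nat) : \sum_(w | P w) F w = \sum_w P w * F w.
Proof.
rewrite [LHS]big_mkcond /=; apply: eq_bigr => w _.
by case: (P w); rewrite ?mul1n ?mul0n.
Qed.

Lemma nwalks1 u v : nwalks 1 u v = e u v.
Proof.
rewrite /= sum_mulb -[RHS](sum_eq1 (e u) v).
by apply: eq_bigr => w _; rewrite mulnC.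
Qed.

Lemma nwalksD i j u v : nwalks (i + j) u v = \sum_w nwalks i u w * nwalks j w v.
Proof.
elim: i u => [|i IHi] u.
  rewrite add0n -[LHS](sum_eq1 (fun w => nwalks j w v) u).
  by apply: eq_bigr => w _; rewrite /= eq_sym.
rewrite addSn /=; under eq_bigr do rewrite IHi.
rewrite exchange_big /=.
by apply: eq_bigr => w _; rewrite big_distrl.
Qed.

Lemma nwalksSr i u v : nwalks i.+1 u v = \sum_(w | e w v) nwalks i u w.
Proof.
rewrite -addn1 nwalksD [RHS]sum_mulb; apply: eq_bigr => w _.
by rewrite nwalks1 mulnC.
Qed.

Lemma nwalks_leS j u v :
  nwalks_le j.+1 u v = (u == v) + \sum_(w | e u w) nwalks_le j w v.
Proof. by rewrite /nwalks_le big_ord_recl /= exchange_big. Qed.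

Lemma nwalks_leSr j u v :
  nwalks_le j.+1 u v = (u == v) + \sum_(w | e w v) nwalks_le j u w.
Proof.
rewrite /nwalks_le big_ord_recl [in RHS]exchange_big; congr (_ + _).
by apply: eq_bigr => i _; rewrite -nwalksSr.
Qed.

Lemma nwalks_lt0D i j u w v :
  0 < nwalks i u w -> 0 < nwalks j w v -> 0 < nwalks (i + j) u v.
Proof.
move=> iw wj; rewrite nwalksD (bigD1 w) //=.
by apply: leq_trans (leq_addr _ _); rewrite muln_gt0 iw.
Qed.

Lemma nwalks_le_gt0 j u v :
  0 < nwalks_le j u v -> exists2 i, i <= j & 0 < nwalks i u v.
Proof.
rewrite lt0n sum_nat_eq0 negb_forall => /existsP[[i /= lti]].
by rewrite -lt0n => ?; exists i.
Qed.

Lemma nwalks_leq_nwalks_le i j u v : i <= j -> nwalks i u v <= nwalks_le j u v.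
Proof.
move=> leij; rewrite /nwalks_le (bigD1 (Ordinal (leij : i < j.+1))) //=.
exact: leq_addr.
Qed.

Lemma sum_nwalks d i u : (forall w, outdeg e w = d) -> \sum_v nwalks i u v = d ^ i.
Proof.
move=> dreg; elim: i u => [|i IHi] u /=.
  by rewrite -[RHS](sum_pred1 u); apply: eq_bigr => w _; rewrite eq_sym.
rewrite exchange_big /= (eq_bigr (fun _ => 1 * d ^ i)) => [|w _]; last by rewrite mul1n.
by rewrite -big_distrl /= outdegE dreg expnS.
Qed.

Lemma sum_nwalks_in d i v : (forall w, indeg w = d) -> \sum_u nwalks i u v = d ^ i.
Proof.
move=> dreg; elim: i v => [|i IHi] v; first by rewrite /= sum_pred1.
under eq_bigr do rewrite nwalksSr.
rewrite exchange_big /=.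
rewrite (eq_bigr (fun _ => 1 * d ^ i)) => [|w _]; last by rewrite mul1n.
by rewrite -big_distrl /= indegE dreg expnS.
Qed.

Lemma sum_indeg : \sum_v indeg v = \sum_u outdeg e u.
Proof.
under eq_bigr do rewrite -indegE sum_mulb.
under [RHS]eq_bigr do rewrite -outdegE.
rewrite exchange_big /=.
by apply: eq_bigr => u _; rewrite [RHS]sum_mulb.
Qed.

Lemma nwalks_card i u v : nwalks i u v = #|[set p : i.-tuple T | walk e u v p]|.
Proof.
rewrite -sum1_card (eq_bigl (fun p : i.-tuple T => walk e u v p)) => [|p]; last first.
  by rewrite inE.
elim: i u => [|i IHi] u /=.
  rewrite (eq_bigl (fun p => (p == [tuple]) && (u == v))) => [|p]; last first.
    by rewrite tuple0 eqxx.
  case: (u == v); last by rewrite big_pred0 // => p; rewrite andbF.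
  by rewrite (eq_bigl (pred1 [tuple])) ?big_pred1_eq // => p; rewrite andbT.
under eq_bigr do rewrite IHi.
rewrite pair_big_dep /=.
rewrite (reindex (fun wp : T * i.-tuple T => [tuple of wp.1 :: wp.2])) /=; last first.
  exists (fun p => (thead p, [tuple of behead p])) => [[w p] _|p _] /=.
    by congr (_, _); apply: val_inj.
  by apply: val_inj => /=; case/tupleP: p.
by apply: eq_bigl => -[w p]; rewrite /walk /= andbA.
Qed.

End Walks.

(** * From geodecity to the outlier map *)

Section Geodetic.

Variables (T : finType) (e : rel T) (k : nat).

Lemma geodetic_nwalks_le1 u v : geodetic e k -> nwalks_le e k u v <= 1.
Proof.
move=> geo.
have le1 (i : 'I_k.+1) : nwalks e i u v <= 1.
  rewrite nwalks_card; apply/card_le1P => p; rewrite inE => wp q; rewrite !inE.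
  apply/idP/eqP => [wq | -> //]; apply: val_inj.
  by apply: (geo u v) => //; rewrite size_tuple -ltnS.
have [-> // | ] := eqVneq (nwalks_le e k u v) 0.
rewrite -lt0n => /nwalks_le_gt0[i]; rewrite -ltnS => lti gt0.
rewrite /nwalks_le (bigD1 (Ordinal lti)) //= big1 ?addn0 ?(le1 (Ordinal lti)) // => j neji.
apply/eqP; apply: contraNT neji; rewrite -lt0n => gt0j.
move: gt0 gt0j; rewrite !nwalks_card => /card_gt0P[p + ] /card_gt0P[q].
rewrite !inE => wp wq; apply/eqP/val_inj => /=.
rewrite -(size_tuple p) -(size_tuple q); congr size.
by apply: (geo u v) => //; rewrite size_tuple -ltnS.
Qed.

End Geodetic.

(** The identity I + A + ... + A^k + P = J read entrywise. Everything about walks below is derived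
    from it, also for subdigraphs. *)
Definition outlier (T : finType) (e : rel T) (k : nat) (o : T -> T) : Prop :=
  forall u v, nwalks_le e k u v + (v == o u) = 1.

Lemma moore_pred d k : moore d k.+1 = 1 + d * moore d k.
Proof.
rewrite /moore big_ord_recl /= big_distrr /=; congr (_ + _).
by apply: eq_bigr => i _; rewrite expnS.
Qed.

Section ExcessOne.

Variables (T : finType) (e : rel T) (d k : nat).

(** A vertex of out-degree above d would start at least 1 + (d + 1) M(d, k-1) = M(d, k) + M(d, k-1)
    walks of length at most k, all with distinct ends, and M(d, k-1) > 1. *)
Lemma excess_one_outregular :
  1 < k -> 1 < d -> excess_one_digraph d k e -> forall u, outdeg e u = d.
Proof.
move=> k1 d1 [geo [mind _] cardT] u; apply/eqP; rewrite eqn_leq mind andbT leqNgt.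
apply/negP => ltd.
have lb i w : d ^ i <= \sum_v nwalks e i w v.
  elim: i w => [|i IHi] w /=.
    by under eq_bigr do rewrite eq_sym; rewrite sum_pred1.
  rewrite exchange_big /=; apply: leq_trans (leq_sum _ _) => [|x _]; last exact: IHi.
  rewrite (eq_bigr (fun=> 1 * d ^ i)) => [|x _]; last by rewrite mul1n.
  by rewrite -big_distrl /= outdegE expnS leq_mul.
have : \sum_v nwalks_le e k u v <= moore d k + 1.
  by rewrite -cardT -sum1_card leq_sum // => v _; exact: geodetic_nwalks_le1.
apply/negP; rewrite -ltnNge.
case: k k1 {geo cardT} => [|[|j]] // _.
have big_lb : d.+1 * moore d j.+1 <= \sum_v \sum_(w | e u w) nwalks_le e j.+1 w v.
  rewrite exchange_big /=; apply: (@leq_trans (\sum_(w | e u w) 1 * moore d j.+1)).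
    by rewrite -big_distrl /= outdegE leq_mul.
  apply: leq_sum => w _; rewrite mul1n /nwalks_le exchange_big /=.
  by apply: leq_sum => i _; apply: lb.
under eq_bigr do rewrite nwalks_leS.
rewrite big_split /=; under eq_bigr do rewrite eq_sym.
rewrite sum_pred1 moore_pred.
have : 1 < moore d j.+1.
  rewrite moore_pred ltnS muln_gt0 (ltnW d1) /= /moore big_ord_recl.
  by rewrite addn_gt0.
move: big_lb; rewrite mulSn; lia.
Qed.

Lemma excess_one_outlier :
  1 < k -> 1 < d -> excess_one_digraph d k e -> exists o, outlier e k o.
Proof.
move=> k1 d1 exc; have [geo _ cardT] := exc.
have oreg := excess_one_outregular k1 d1 exc.
have le1 u v := geodetic_nwalks_le1 u v geo.
have total u : \sum_v nwalks_le e k u v = moore d k.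
  rewrite /nwalks_le exchange_big /=; apply: eq_bigr => i _; exact: sum_nwalks.
have unreached u : exists v, nwalks_le e k u v == 0.
  apply/existsP; apply: contraT; rewrite negb_exists => /forallP all1.
  suff : #|T| <= moore d k by rewrite cardT addn1 ltnn.
  by rewrite -(total u) -sum1_card leq_sum // => v _; rewrite lt0n.
pose o u := xchoose (unreached u); exists o => u v.
have [-> | nev] := eqVneq v (o u); first by rewrite (eqP (xchooseP (unreached u))).
rewrite addn0; apply/eqP; rewrite eqn_leq le1 ltnNge leqn0; apply/negP => /eqP v0.
(* Were [v] and [o u] both unreached, the [moore d k] reached vertices and these two would exceed
   the order. *)
suff : moore d k + 2 <= #|T| by rewrite cardT leq_add2l.
have -> : moore d k + 2 = \sum_w (nwalks_le e k u w + ((w == v) + (w == o u))).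
  by rewrite !big_split /= !sum_pred1 total.
rewrite -sum1_card leq_sum // => w _.
have [-> | _] := eqVneq w v; first by rewrite (negPf nev) v0.
by have [-> | _] := eqVneq w (o u); rewrite ?(eqP (xchooseP (unreached u))) // addn0.
Qed.

End ExcessOne.

(** * The outlier map *)

Section Outlier.

Variables (T : finType) (e : rel T) (k : nat) (o : T -> T).
Hypothesis out : outlier e k o.

Lemma outlier_le1 u v : nwalks_le e k u v <= 1.
Proof. by rewrite -(out u v) leq_addr. Qed.

Lemma outlier_size i j u v :
  i <= k -> j <= k -> 0 < nwalks e i u v -> 0 < nwalks e j u v -> i = j.
Proof.
move=> leik lejk gt0i gt0j; apply/eqP; apply: contraT => neij.
have := outlier_le1 u v; rewrite /nwalks_le (bigD1 (Ordinal (leik : i < k.+1))) //=.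
rewrite (bigD1 (Ordinal (lejk : j < k.+1))) /=; last by rewrite eq_sym.
by rewrite addnA leqNgt => /negP[]; apply: ltn_addr; apply: (@leq_add 1 1).
Qed.

Lemma outlier_closed i u : i <= k -> 0 < nwalks e i u u -> i = 0.
Proof. by move=> leik gt0; apply: (outlier_size leik _ gt0) => //=; rewrite eqxx. Qed.

Lemma outlier_step i u a b v : i < k -> e u a -> e u b ->
  0 < nwalks e i a v -> 0 < nwalks e i b v -> a = b.
Proof.
move=> ltik eua eub gt0a gt0b; apply/eqP; apply: contraT => neab.
have := outlier_le1 u v; rewrite leqNgt => /negP[].
apply: leq_trans (nwalks_leq_nwalks_le _ _ _ ltik); rewrite /= (bigD1 a) //=.
rewrite (bigD1 b) /=; last by rewrite eub eq_sym.
by rewrite addnA; apply: ltn_addr; apply: (@leq_add 1 1).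
Qed.

Lemma outlier_neq u : o u != u.
Proof.
apply/eqP => ou; have := out u u.
by rewrite ou eqxx /nwalks_le big_ord_recl /= eqxx addn1 => -[].
Qed.

(** The sum is an entry of A(I + ... + A^k) = (I + ... + A^k)A = JA - PA. *)
Lemma outlier_nbr_sum u v :
  \sum_(w | e u w) nwalks_le e k w v + e (o u) v = indeg e v.
Proof.
have -> : \sum_(w | e u w) nwalks_le e k w v = \sum_(w | e w v) nwalks_le e k u w.
  by apply: (@addnI (u == v)); rewrite -nwalks_leS nwalks_leSr.
rewrite -indegE -(eq_bigr _ (fun w _ => out u w)) big_split /=; congr (_ + _).
rewrite -(sum_eq1 (fun w => nat_of_bool (e w v))) [RHS]sum_mulb.
by apply: eq_bigr => w _; rewrite mulnC.
Qed.

(* [A] commutes with [I + A + ... + A^k = J - P], where [P] is the matrix of [o]. *)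
Lemma outlier_comm u v :
  outdeg e u + e (o u) v = indeg e v + \sum_(w | e u w) (v == o w).
Proof.
rewrite -(outlier_nbr_sum u) -outdegE addnAC -big_split; congr (_ + _).
by apply: eq_bigr => w _; rewrite /= out.
Qed.

Lemma outlier_card d (x : T) : (forall w, outdeg e w = d) -> #|T| = moore d k + 1.
Proof.
move=> oreg; rewrite -sum1_card -(eq_bigr _ (fun v _ => out x v)) big_split /= sum_pred1.
rewrite exchange_big /=; congr (_ + _).
by apply: eq_bigr => i _; apply: sum_nwalks.
Qed.

End Outlier.

(** * Orbits of an injective map *)

Section Orders.

Variables (T : finType) (f : T -> T).
Hypothesis injf : injective f.

Lemma order_dvdn n x : (order f x %| n) = (iter n f x == x).
Proof.
have iterx q : iter (q * order f x) f x = x by rewrite iterM iter_fix ?iter_order.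
apply/idP/eqP => [/dvdnP[q ->] // | fix_n].
rewrite /dvdn -(findex_iter (ltn_pmod n (order_gt0 f x))).
suff -> : iter (n %% order f x) f x = x by rewrite findex0.
by rewrite -[in RHS]fix_n {2}(divn_eq n (order f x)) addnC iterD iterx.
Qed.

Lemma order_f x : order f (f x) = order f x.
Proof.
apply/eqP; rewrite eqn_dvd !order_dvdn -iterSr iterS iter_order // eqxx /=.
by rewrite -(inj_eq injf) -iterS iterSr iter_order.
Qed.

Lemma dvdn_card_order n (A : {pred T}) :
  fclosed f A -> {in A, forall x, order f x = n} -> n %| #|A|.
Proof.
move=> clA ordA; rewrite -(@fcard_order_set _ _ injf n) ?dvdn_mull //.
by apply/subsetP => x /ordA ordx; rewrite inE ordx.
Qed.

End Orders.

(** * Closed walks up to rotation *)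

Section ClosedWalks.

Variables (T : finType) (e : rel T).

Lemma sum_nwalks_closed m :
  0 < m -> \sum_u nwalks e m u u = #|[pred p : m.-tuple T | cycle e p]|.
Proof.
case: m => // m _; under eq_bigr do rewrite nwalks_card -sum1_card.
rewrite (exchange_big_dep predT) //= -sum1_card [RHS]big_mkcond /=.
apply: eq_bigr => p _; pose x := thead p.
have lastE u : last u p = last x p by case/tupleP: p @x => y q.
under eq_bigl do rewrite inE /walk lastE.
rewrite inE /= (cycle_path x); case: ifP => [cyc | ncyc].
  rewrite (eq_bigl (pred1 (last x p))) ?big_pred1_eq // => u /=.
  by rewrite [RHS]eq_sym; case: eqP => [<-|]; rewrite ?cyc ?andbF.
by rewrite big_pred0 // => u; case: eqP => [<-|]; rewrite ?ncyc ?andbF.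
Qed.

(** Rotation by one acts on the closed walks of length m. An orbit of size r < m would have r
    dividing m, and the first r vertices of its members would form a closed walk of length r; so all
    orbits have size m. *)
Lemma dvdn_sum_closed m : 0 < m ->
  (forall i v, 0 < i -> i < m -> i %| m -> nwalks e i v v = 0) ->
  m %| \sum_u nwalks e m u u.
Proof.
move=> m0 noclosed; rewrite sum_nwalks_closed //.
pose f (p : m.-tuple T) : m.-tuple T := [tuple of rot 1 p].
have injf : injective f by move=> p q /(congr1 val)/rot_inj/val_inj.
have fiter i (p : m.-tuple T) : i <= m -> val (iter i f p) = rot i p.
  elim: i => [|i IHi] lei; first by rewrite rot0.
  by rewrite iterS /= IHi 1?ltnW // -rotS // size_tuple.
apply: (dvdn_card_order injf) => [p q /eqP <-|p]; first by rewrite !inE /= rot_cycle.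
rewrite inE /= => cyc.
have ordp : order f p %| m.
  by rewrite order_dvdn //; apply/eqP/val_inj; rewrite fiter // -{1}(size_tuple p) rot_size.
apply/eqP; rewrite eqn_leq dvdn_leq // leqNgt; apply/negP => ltm.
have rotp : rot (order f p) p = p :> seq T by rewrite -fiter ?iter_order // ltnW.
have ord0 := order_gt0 f p.
pose x0 := tnth p (Ordinal m0); pose x := last x0 p.
suff: 0 < nwalks e (order f p) x x by rewrite noclosed.
(* Rotation by [order f p] fixes [p], so this prefix of [p] ends at the same vertex as [p]
   itself. *)
have lastp y : last y (take (order f p) p) = x.
  rewrite /x -{2}rotp /rot last_cat; set s := take _ _.
  have : 0 < size s by rewrite size_take size_tuple ltm.
  by case: s.
rewrite nwalks_card; apply/card_gt0P.
have szt : size (take (order f p) p) == order f p by rewrite size_take size_tuple ltm.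
exists (Tuple szt); rewrite inE /walk /= lastp eqxx andbT.
by move: cyc; rewrite (cycle_path x0) -{2}(cat_take_drop (order f p) p) cat_path => /andP[].
Qed.

End ClosedWalks.

(** * Out-regular digraphs with an outlier map *)

Section OutRegular.

Variables (T : finType) (e : rel T) (k d : nat) (o : T -> T).
Hypotheses (out : outlier e k o) (oreg : forall u, outdeg e u = d).

Lemma indeg_excess (s : T) : (forall v, indeg e v <= d) -> indeg e s = d.
Proof.
move=> le_d; apply/eqP; rewrite eqn_leq le_d leqNgt; apply/negP => lt_s.
have := sum_indeg e; under [RHS]eq_bigr => i _ do rewrite oreg.
apply/eqP; rewrite ltn_eqF // (bigD1 s) //= [X in _ < X](bigD1 s) //= -addSn.
by apply: leq_add => //; apply: leq_sum.
Qed.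

(* The identity [outlier_comm] forces every out-neighbour of an outlier that
   does not have excess in-degree to be an outlier itself.  Both outliers would
   then have an arc to [s], giving walks of lengths 1 and 2. *)
Lemma outlier_out_nbr s u v : 1 < k -> d < indeg e s -> e (o u) v = (d < indeg e v).
Proof.
move=> k1 lt_s.
have to_excess w x : d < indeg e x -> e (o w) x.
  move=> lt_x; have := outlier_comm out w x; rewrite oreg.
  case: (e (o w) x) => //; rewrite addn0 => dE.
  by move: lt_x; rewrite dE ltnNge leq_addr.
apply/idP/idP => [ouv | ]; last exact: to_excess.
rewrite ltnNge; apply/negP => le_v.
have : 0 < \sum_(w | e u w) (v == o w).
  by have := outlier_comm out u v; rewrite oreg ouv; lia.
rewrite lt0n sum_nat_eq0 negb_forall => /existsP[w].
rewrite negb_imply eqb0 negbK => /andP[_ /eqP vE].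
have vs : e v s by rewrite vE to_excess.
have two_walks : 1 = 2.
  apply: (outlier_size out (ltnW k1) k1 (u := o u) (v := s)).
    by rewrite nwalks1 to_excess.
  apply: (@nwalks_lt0D _ _ 1 1 _ v); rewrite nwalks1 ?ouv ?vs //.
by [].
Qed.

(* The rows of [A + ... + A^(k+1)], hence those of [A^(k+2) - A], are all equal. *)
Lemma irregular_closed_walks s : 1 < k -> d < indeg e s ->
  \sum_u nwalks e (2 * k).+1 u u + d ^ k = d ^ (2 * k).+1.
Proof.
move=> k1 lt_s.
(* [c v] and [c' v] are the constant values in column [v] of A + ... + A^(k+1) and A^2 + ... +
   A^(k+2). *)
pose c v := indeg e v - (d < indeg e v); pose c' v := \sum_(w | e w v) c w.
have cE u v : \sum_(i < k.+1) nwalks e i.+1 u v = c v.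
  have := outlier_nbr_sum out u v; rewrite (outlier_out_nbr u v k1 lt_s).
  by rewrite /nwalks_le exchange_big /c => sumE; rewrite -[X in X - _]sumE addnK.
have c'E u v : \sum_(i < k.+1) nwalks e i.+2 u v = c' v.
  under eq_bigr do rewrite nwalksSr.
  by rewrite exchange_big; apply: eq_bigr => w _; apply: cE.
have rec u v : nwalks e k.+2 u v + c v = nwalks e 1 u v + c' v.
  rewrite -(cE u v) -(c'E u v).
  rewrite [in X in _ = _ + X]big_ord_recr [X in _ + X = _]big_ord_recl addnCA.
  by rewrite [X in _ + X]addnC.
have kE : k = k.-1 + 1 by lia.
(* Multiply [rec] by A^(k-1) and read the diagonal, where A^k vanishes. *)
have rec2 u : nwalks e (2 * k).+1 u u + d ^ k.-1 * c u = d ^ k.-1 * c' u.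
  have -> : (2 * k).+1 = k.-1 + k.+2 by lia.
  have sumE F : \sum_w nwalks e k.-1 u w * F = d ^ k.-1 * F.
    by rewrite -big_distrl /= (sum_nwalks _ _ oreg).
  rewrite nwalksD -[in LHS]sumE -big_split /=.
  under eq_bigr do rewrite -mulnDr rec mulnDr.
  rewrite big_split -nwalksD sumE -kE.
  suff -> : nwalks e k u u = 0 by [].
  by apply/eqP; rewrite -leqn0 leqNgt; apply/negP => /(outlier_closed out (leqnn k)); lia.
(* A row sum of [rec], which eliminates the unknown sums of [c] and [c']. *)
have tot : d ^ k.+2 + \sum_v c v = d + \sum_v c' v.
  rewrite -(sum_nwalks _ s oreg) -[X in X + \sum_v c' v](sum_nwalks 1 s oreg).
  by rewrite -!big_split; apply: eq_bigr => v _; apply: rec.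
have : \sum_u nwalks e (2 * k).+1 u u + d ^ k.-1 * \sum_v c v = d ^ k.-1 * \sum_v c' v.
  rewrite !big_distrr -big_split; apply: eq_bigr => u _; exact: rec2.
have -> : d ^ (2 * k).+1 = d ^ k.-1 * d ^ k.+2 by rewrite -expnD; congr (_ ^ _); lia.
have -> : d ^ k = d ^ k.-1 * d by rewrite -expnSr prednK // ltnW.
nia.
Qed.

Lemma irregular_dvdn s : 1 < k -> d < indeg e s -> 2 * k + 1 %| d ^ k * (d ^ k.+1 - 1).
Proof.
move=> k1 lt_s; have closed := irregular_closed_walks k1 lt_s.
have -> : d ^ k * (d ^ k.+1 - 1) = \sum_u nwalks e (2 * k).+1 u u.
  rewrite mulnBr muln1 -expnD -[RHS](addnK (d ^ k)) closed; congr (_ ^ _ - _); lia.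
rewrite addn1; apply: dvdn_sum_closed => // i v i0 lti /dvdnP[q qE].
apply/eqP; rewrite -leqn0 leqNgt; apply/negP => /(outlier_closed out _) i0'.
suff : i <= k by move/i0'; lia.
(* Since 2k + 1 is odd, the cofactor [q] is at least 3, hence [i <= k]. *)
have : 1 < q by nia.
rewrite leq_eqVlt => /orP[/eqP q2 | q3]; first by move: qE; rewrite -q2; lia.
nia.
Qed.

Hypothesis ireg : forall v, indeg e v = d.

Lemma regular_outlier_sum u v : \sum_(w | e u w) (v == o w) = e (o u) v.
Proof. by have := outlier_comm out u v; rewrite oreg ireg => /addnI. Qed.

(** With all in-degrees d, each column of I + ... + A^k sums to M(d, k), leaving column sum 1 for
    P. *)
Lemma regular_outlier_inj : injective o.
Proof.
move=> u v ouv; have cardT := outlier_card out u oreg.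
have total : \sum_w (o u == o w) = 1.
  apply: (@addnI (moore d k)); rewrite -cardT -sum1_card.
  under [RHS]eq_bigr => i _ do rewrite -(out i (o u)).
  rewrite big_split /=; congr (_ + _).
  rewrite exchange_big /moore; apply: eq_bigr => i _.
  by rewrite (sum_nwalks_in i (o u) ireg).
apply/eqP; apply: contraT => neuv; have := total.
by rewrite (bigD1 u) //= (bigD1 v) 1?eq_sym //= ouv !eqxx.
Qed.

Lemma regular_outlier_aut u v : e (o u) (o v) = e u v.
Proof.
apply/idP/idP => [| uv].
  rewrite -[e (o u) _]lt0b -regular_outlier_sum lt0n sum_nat_eq0 negb_forall => /existsP[w].
  by rewrite negb_imply eqb0 negbK => /andP[uw /eqP/regular_outlier_inj ->].
by rewrite -[e (o u) _]lt0b -regular_outlier_sum (bigD1 v) //= eqxx.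
Qed.

End OutRegular.

(** * Outlier maps that are automorphisms *)

Section Automorphism.

Variables (T : finType) (e : rel T) (k : nat) (o : T -> T).
Hypotheses (out : outlier e k o) (injo : injective o).
Hypothesis aut : forall u v, e (o u) (o v) = e u v.

(** Here AP = PA cancels from [outlier_comm], so diregularity comes for free; this serves the fixed
    subdigraphs, whose degree is not known in advance. *)
Lemma aut_outdeg_indeg u v : outdeg e u = indeg e v.
Proof.
rewrite -(f_finv injo v); set w := finv o v.
have := outlier_comm out u (o w); rewrite aut.
have -> : \sum_(x | e u x) (o w == o x) = e u w.
  rewrite sum_mulb -[RHS](sum_eq1 (fun x => nat_of_bool (e u x))).
  by apply: eq_bigr => x _; rewrite (inj_eq injo) eq_sym mulnC.
by move/addIn.
Qed.

Lemma aut_iter r u v : e (iter r o u) (iter r o v) = e u v.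
Proof. by elim: r => // r IHr; rewrite !iterS aut. Qed.

Lemma iter_inj r : injective (iter r o).
Proof. by elim: r => // r IHr u v; rewrite !iterS => /injo/IHr. Qed.

Lemma nwalks_iter r i u v : nwalks e i (iter r o u) (iter r o v) = nwalks e i u v.
Proof.
elim: i u => [|i IHi] u /=; first by rewrite (inj_eq (@iter_inj r)).
rewrite (reindex_inj (@iter_inj r)) /=.
by apply: eq_big => w; rewrite ?aut_iter.
Qed.

Section Fixed.

Variable r : nat.

Definition fixed := {x : T | x \in [pred x | iter r o x == x]}.

Definition fixed_rel (x y : fixed) : bool := e (val x) (val y).

Lemma fixedP (x : fixed) : iter r o (val x) = val x.
Proof. exact/eqP/(valP x). Qed.

Lemma fixed_closed (x : fixed) : o (val x) \in [pred x | iter r o x == x].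
Proof. by rewrite inE -iterSr iterS fixedP. Qed.

Definition fixed_outlier (x : fixed) : fixed := exist _ (o (val x)) (fixed_closed x).

Lemma sum_fixed (F : T -> nat) x :
  \sum_(y | fixed_rel x y) F (val y) =
  \sum_(w | (iter r o w == w) && e (val x) w) F w.
Proof. exact/esym/big_sub_cond. Qed.

(** A walk of length at most k between fixed vertices stays among fixed vertices: [iter r o] maps it
    to a walk with the same ends, so uniqueness fixes its first step. *)
Lemma nwalks_fixed i x y : i <= k -> nwalks fixed_rel i x y = nwalks e i (val x) (val y).
Proof.
elim: i x => [|i IHi] x lei; first by [].
rewrite /= (eq_bigr (fun w => nwalks e i (val w) (val y))) => [|w _]; last exact/IHi/ltnW.
rewrite (sum_fixed (fun w => nwalks e i w (val y))) big_mkcondl /=.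
apply: eq_bigr => w exw; case: eqP => // nfix.
apply/esym/eqP; rewrite -leqn0 leqNgt; apply/negP => gt0; apply: nfix.
apply: (outlier_step out lei _ exw _ gt0).
  by rewrite -(fixedP x) aut_iter.
by rewrite -(fixedP y) nwalks_iter.
Qed.

Lemma fixed_is_outlier : outlier fixed_rel k fixed_outlier.
Proof.
move=> x y; rewrite -[RHS](out (val x) (val y)); congr (_ + _).
by apply: eq_bigr => -[i lti] _; apply: nwalks_fixed.
Qed.

Lemma fixed_outlier_inj : injective fixed_outlier.
Proof. by move=> x y /(congr1 val)/injo/val_inj. Qed.

Lemma fixed_aut x y :
  fixed_rel (fixed_outlier x) (fixed_outlier y) = fixed_rel x y.
Proof. exact: aut. Qed.

Lemma outdeg_fixed x : outdeg fixed_rel x <= outdeg e (val x).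
Proof.
rewrite -!outdegE (sum_fixed (fun=> 1)) big_mkcondl /=.
by apply: leq_sum => w _; case: ifP.
Qed.

Lemma card_fixed : #|[set x | iter r o x == x]| = #|{: fixed}|.
Proof. by rewrite card_sig cardsE. Qed.

Lemma val_iter_fixed i x : val (iter i fixed_outlier x) = iter i o (val x).
Proof. by elim: i => // i IHi; rewrite !iterS /= IHi. Qed.

End Fixed.

(** The digraph is a (k + 2)-cycle on which [o] is the predecessor map. Going back r times and
    forward r times shows that the order of [u] is the length of a closed walk, hence neither at
    most k nor k + 1. *)
Lemma outdeg1_order (u : T) : 0 < k -> (forall v, outdeg e v = 1) -> order o u = k.+2.
Proof.
move=> k0 oreg.
have ireg v : indeg e v = 1 by rewrite -(aut_outdeg_indeg v).
have sumE w v : \sum_(i < k.+1) nwalks e i.+1 w v + e (o w) v = 1.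
  by rewrite -[RHS](ireg v) -(outlier_nbr_sum out w) /nwalks_le exchange_big.
have loop v : e v v = false.
  apply/negP => ev; suff: 1 = 0 by [].
  by apply: (outlier_closed out (u := v) k0); rewrite nwalks1 ev.
have to_out w : nwalks e k.+1 w (o w) = 1.
  have := sumE w (o w); rewrite loop addn0 big_ord_recr.
  rewrite big1 // => -[i lti] _; apply/eqP; rewrite -leqn0 leqNgt; apply/negP => gt0.
  have := out w (o w); rewrite eqxx.
  have := leq_trans gt0 (nwalks_leq_nwalks_le _ _ _ lti); lia.
have no_return w : nwalks e k.+1 w w = 0.
  have := sum_nwalks k.+1 w oreg; rewrite exp1n.
  move: (nwalks e k.+1 w) (to_out w) => F Fo.
  rewrite (bigD1 (o w)) //= Fo (bigD1 w) /=; last by rewrite eq_sym (outlier_neq out).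
  lia.
have back w : e (o w) w.
  have := sumE w w; rewrite big_ord_recr no_return big1 => [|[i lti] _].
    by rewrite !add0n => /eqP; rewrite eqb1.
  apply/eqP; rewrite -leqn0 leqNgt; apply/negP => /(outlier_closed out lti).
  by [].
have walk_back r w : 0 < nwalks e r (iter r o w) w.
  elim: r => [|r IHr]; first by rewrite /= eqxx.
  by apply: (@nwalks_lt0D _ _ 1 r _ (iter r o w)); rewrite // nwalks1 iterS back.
have := walk_back (order o u) u; rewrite iter_order // => closed.
have ub : order o u <= k.+2.
  have -> : k.+2 = #|T|.
    rewrite (outlier_card out u oreg) /moore; under eq_bigr do rewrite exp1n.
    by rewrite sum1_card card_ord addn1.
  exact: max_card.
have lb : k < order o u.
  rewrite ltnNge; apply/negP => /(outlier_closed out)/(_ closed).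
  by have := order_gt0 o u; lia.
have : order o u != k.+1.
  by apply: contraTneq closed => ->; rewrite no_return.
lia.
Qed.

End Automorphism.

(** * Degree two *)

Section OutDegreeTwo.

Variables (T : finType) (e : rel T) (k : nat) (o : T -> T).
Hypotheses (out : outlier e k o) (injo : injective o).
Hypothesis aut : forall u v, e (o u) (o v) = e u v.
Hypotheses (k2 : 2 < k) (oreg : forall u, outdeg e u = 2).

Lemma other_out_nbr u c : e u c -> exists2 c', e u c' & c' != c.
Proof.
move=> euc; have : 0 < #|[set v | e u v] :\ c|.
  have := oreg u; rewrite /outdeg (cardsD1 c) inE euc; lia.
by move/card_gt0P => [c']; rewrite !inE => /andP[]; exists c'.
Qed.

Lemma sum_out_nbrs (F : T -> nat) u c c' :
  e u c -> e u c' -> c' != c -> \sum_(w | e u w) F w = F c + F c'.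
Proof.
move=> euc euc' nec; rewrite (bigD1 c) //= (bigD1 c') /= ?euc' //.
rewrite big1 ?addn0 // => w /andP[/andP[euw newc] newc'].
have := oreg u; rewrite -outdegE (bigD1 c) //= (bigD1 c') /= ?euc' //.
by rewrite (bigD1 w) // euw newc.
Qed.

(** Expand the row identities of [u] and [v] by first arc and cancel the branch through the common
    out-neighbour [c]. *)
Lemma outlier_exchange u v c u2 v2 y :
  e u c -> e v c -> e u u2 -> e v v2 -> u2 != c -> v2 != c ->
  (y == u) + nwalks_le e k.-1 u2 y + (y == o u) =
  (y == v) + nwalks_le e k.-1 v2 y + (y == o v).
Proof.
move=> euc evc euu2 evv2 neu nev.
have outE w w2 : e w c -> e w w2 -> w2 != c ->
  nwalks_le e k.-1 c y + ((y == w) + nwalks_le e k.-1 w2 y + (y == o w)) = 1.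
  move=> ewc eww2 new; rewrite -[RHS](out w y) -[in RHS](prednK (ltnW (ltnW k2))).
  by rewrite nwalks_leS (sum_out_nbrs _ ewc eww2 new) eq_sym; lia.
by apply: (@addnI (nwalks_le e k.-1 c y)); rewrite !outE.
Qed.

(** The exchange identity at [y = u2] leaves, besides the two conclusions, a walk of some length 0 <
    j < k from [v2] to [u2], which must be excluded. *)
Lemma common_out_nbr u v c u2 v2 : u != v ->
  e u c -> e v c -> e u u2 -> e v v2 -> u2 != c -> v2 != c -> u2 = v2 \/ u2 = o v.
Proof.
move=> neuv euc evc euu2 evv2 neu nev.
have not_eu2v : ~ e u2 v.
  move=> eu2v; suff: 1 = 3 by [].
  apply: (outlier_size out _ k2 (u := u) (v := c)); first exact: ltnW (ltnW _).
    by rewrite nwalks1 euc.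
  apply: (@nwalks_lt0D _ _ 1 2 _ u2); first by rewrite nwalks1 euu2.
  by apply: (@nwalks_lt0D _ _ 1 1 _ v); rewrite nwalks1 ?eu2v ?evc.
have exch y := outlier_exchange y euc evc euu2 evv2 neu nev.
have : (u2 == v) || (0 < nwalks_le e k.-1 v2 u2) || (u2 == o v).
  have : 0 < nwalks_le e k.-1 u2 u2.
    by apply: leq_trans (nwalks_leq_nwalks_le _ _ _ (leq0n _)); rewrite /= eqxx.
  have := exch u2; lia.
case/orP => [/orP[/eqP u2v | /nwalks_le_gt0[j lej gt0j]] | /eqP]; last by right.
  suff: 1 = 2 by [].
  apply: (outlier_size out _ (ltnW k2) (u := u) (v := c)); first exact: ltnW (ltnW _).
    by rewrite nwalks1 euc.
  by apply: (@nwalks_lt0D _ _ 1 1 _ u2); rewrite nwalks1 ?euu2 // u2v evc.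
have [j0 | j0] := posnP j.
  by left; move: gt0j; rewrite j0 lt0b => /eqP.
exfalso.
(* Such a [w] lies at the end of a walk of length k from [v2], hence of no shorter one, and the
   exchange identity leaves only [v] and [o v]. *)
have far w : 0 < nwalks e (k - j) u2 w -> (w == v) || (w == o v).
  move=> gt0; have : 0 < nwalks_le e k.-1 u2 w.
    by apply: leq_trans gt0 (nwalks_leq_nwalks_le _ _ _ _); lia.
  have : nwalks_le e k.-1 v2 w = 0.
    apply/eqP; rewrite -leqn0 leqNgt; apply/negP => /nwalks_le_gt0[i lei gt0i].
    have := outlier_size out _ (leqnn k) gt0i.
    rewrite -{2}(subnKC (n := k) (m := j)); last lia.
    move=> /(_ _ (nwalks_lt0D gt0j gt0)); lia.
  have := exch w; lia.
have le_far w : nwalks e (k - j) u2 w <= (w == v) + (w == o v).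
  have [-> // | gt0] := posnP (nwalks e (k - j) u2 w).
  have le1 : nwalks e (k - j) u2 w <= 1.
    by apply: leq_trans (nwalks_leq_nwalks_le _ _ _ (leq_subr _ _)) (outlier_le1 out _ _).
  apply: leq_trans le1 _; have := far w gt0; lia.
(* The 2^(k-j) walks have at most two ends. So [u2] has arcs to both [v] and [o v], and the former
   is excluded by [not_eu2v]. *)
have kj1 : k - j = 1.
  have : 2 ^ (k - j) <= 2.
    rewrite -(sum_nwalks _ u2 oreg); apply: leq_trans (leq_sum _ _) _ => [w _|].
      exact: le_far.
    by rewrite big_split /= !sum_pred1.
  rewrite -{2}(expn1 2) leq_exp2l //; lia.
move: le_far; rewrite kj1 => le_far.
have : \sum_w nwalks e 1 u2 w = 2 by rewrite (sum_nwalks 1 u2 oreg).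
apply/eqP; rewrite ltn_eqF //.
have -> : 2 = \sum_w ((w == v) + (w == o v)) by rewrite big_split /= !sum_pred1.
rewrite (bigD1 v) //= [X in _ < X](bigD1 v) //= eqxx -addSn.
apply: leq_add; last by apply: leq_sum => w _; apply: le_far.
rewrite -[\sum_(w | e u2 w) _]/(nwalks e 1 u2 v) nwalks1.
by move/negP/negPf: not_eu2v => ->.
Qed.

(* If the second out-neighbours [u2 = o v] and [v2 = o u] of [u] and [v] were
   different, then the paths [u, o v, o^2 u, ...] and [v, o u, o^2 v, ...] would
   have common out-neighbours [o^i c] at each level [i], and their ends would
   have to be [v] and [u]; following the first one through [v] then gives two
   walks from its vertex of index 2 to that of the second. *)
Lemma common_out_nbr_eq u v c u2 v2 : u != v ->
  e u c -> e v c -> e u u2 -> e v v2 -> u2 != c -> v2 != c -> u2 = v2.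
Proof.
move=> neuv euc evc euu2 evv2 neu nev.
have [// | u2E] := common_out_nbr neuv euc evc euu2 evv2 neu nev.
have [// | v2E] : v2 = u2 \/ v2 = o u.
  by apply: (common_out_nbr _ evc euc evv2 euu2 nev neu); rewrite eq_sym.
exfalso; rewrite {u2}u2E in euu2 neu; rewrite {v2}v2E in evv2 nev.
pose p (s : bool) := if s then v else u.
(* Vertex [i] of the path starting at [p s]: powers of [o] applied to [u] and [v] alternately. *)
pose z s i := iter i o (p (odd i (+) s)).
have pc s : e (p s) c by case: s.
have po s : e (p s) (o (p (~~ s))) by case: s.
have poc s : o (p s) != c by case: s.
have zS s i : e (z s i) (z s i.+1).
  by rewrite /z iterSr (aut_iter aut) oddS addNb.
have zc s i : e (z s i) (iter i o c) by rewrite /z (aut_iter aut).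
have zSc s i : z s i.+1 != iter i o c.
  by rewrite /z iterSr (inj_eq (@iter_inj _ _ injo i)).
have zwalk s i j : 0 < nwalks e j (z s i) (z s (i + j)).
  elim: j i => [|j IHj] i; first by rewrite addn0 /= eqxx.
  apply: (@nwalks_lt0D _ _ 1 j _ (z s i.+1)); first by rewrite nwalks1 zS.
  by rewrite addnS -addSn.
pose cnt y s i n := \sum_(l < n) (y == z s (i + l)).
have cntS y s i n : cnt y s i n.+1 = (y == z s i) + cnt y s i.+1 n.
  rewrite /cnt big_ord_recl addn0; congr (_ + _).
  by apply: eq_bigr => l _; rewrite addSnnS.
(* At each level both paths branch off to the same vertex [iter i o c], so only the path vertices
   distinguish the two counts. *)
have ladder y m i : nwalks_le e m (z false i) y + cnt y true i m.+1 =
                    nwalks_le e m (z true i) y + cnt y false i m.+1.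
  elim: m i => [|m IHm] i.
    by rewrite /cnt /nwalks_le !big_ord1 /= !addn0 !(eq_sym y) addnC.
  have := IHm i.+1; rewrite !nwalks_leS !(sum_out_nbrs _ (zc _ i) (zS _ i) (zSc _ i)).
  rewrite !(cntS _ _ i) !(eq_sym _ y); lia.
(* So [u] with vertices 2 to k of its path and [v] with vertices 2 to k of its path are the same
   multiset. *)
have exch y s : (y == p s) + \sum_(l < k.-1) (y == z s l.+2) =
                (y == p (~~ s)) + \sum_(l < k.-1) (y == z (~~ s) l.+2).
  have := ladder y k.-1 1; rewrite prednK; last lia.
  have kS : k = k.-1.+1 by lia.
  rewrite kS !cntS -kS.
  have := outlier_exchange y euc evc euu2 evv2 neu nev.
  rewrite -[o u]/(z true 1) -[o v]/(z false 1) -![\sum_(l < k.-1) _]/(cnt y _ 2 k.-1).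
  case: s => /=; lia.
have end_swap s : p s = z (~~ s) k.
  have : 0 < (p s == p (~~ s)) + \sum_(l < k.-1) (p s == z (~~ s) l.+2).
    by rewrite -exch eqxx.
  have -> : (p s == p (~~ s)) = false.
    by rewrite /p; case: (s) => /=; rewrite ?(negPf neuv) // eq_sym (negPf neuv).
  rewrite add0n lt0n sum_nat_eq0 negb_forall => /existsP[[l /= ltl]].
  rewrite eqb0 negbK => /eqP psE.
  have [lek | ] := leqP l.+3 k; last first.
    by move=> gtk; rewrite psE; congr z; lia.
  suff: 1 = l.+3 by [].
  apply: (outlier_size out _ lek (u := p (~~ s)) (v := c)); first by lia.
    by rewrite nwalks1 pc.
  rewrite -(addn1 l.+2); apply: (@nwalks_lt0D _ _ _ 1 _ (p s)); last by rewrite nwalks1 pc.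
  by rewrite psE; apply: (zwalk (~~ s) 0).
have : 0 < (z true 2 == u) + \sum_(l < k.-1) (z true 2 == z false l.+2).
  rewrite (exch _ false) /=; apply: ltn_addl.
  have lt0 : 0 < k.-1 by lia.
  by rewrite (bigD1 (Ordinal lt0)) //= eqxx.
rewrite addn_gt0 lt0b => /orP[/eqP z2 |].
  suff: k - 2 = 0 by lia.
  apply: (outlier_closed out (u := z true 2)); first exact: leq_subr.
  have := zwalk true 2 (k - 2); rewrite (subnKC (ltnW k2)).
  by rewrite -[z true k]/(z (~~ false) k) -end_swap /p -z2.
rewrite lt0n sum_nat_eq0 negb_forall => /existsP[[l /= ltl]].
rewrite eqb0 negbK => /eqP z2.
suff: l = k by lia.
apply: (outlier_size out _ (leqnn k) (u := z false 2) (v := z true 2)); first by lia.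
  by rewrite z2; apply: (zwalk false 2 l).
have := zwalk false 2 (k - 2); rewrite (subnKC (ltnW k2)).
rewrite -[z false k]/(z (~~ true) k) -end_swap => gt0.
by have := nwalks_lt0D gt0 (zwalk true 0 2); rewrite (subnK (ltnW k2)).
Qed.

(** Once the second out-neighbours agree, the exchange identity at [y = v] reads
    [(v == o u) = 1]. *)
Lemma outlier_swap u v c : u != v -> e u c -> e v c -> v = o u /\ forall w, e u w = e v w.
Proof.
move=> neuv euc evc.
have [u2 euu2 neu] := other_out_nbr euc; have [v2 evv2 nev] := other_out_nbr evc.
have u2E := common_out_nbr_eq neuv euc evc euu2 evv2 neu nev.
split.
  have := outlier_exchange v euc evc euu2 evv2 neu nev.
  rewrite u2E eqxx (eq_sym v u) (negPf neuv) (eq_sym v (o v)) (negPf (outlier_neq out v)).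
  by case: (eqVneq v (o u)) => // _; lia.
move=> w.
have nbrs x : e x c -> e x u2 -> e x w = (c == w) + (u2 == w) :> nat.
  move=> exc exu2; rewrite -(sum_out_nbrs (fun y => nat_of_bool (y == w)) exc exu2 neu).
  rewrite sum_mulb -[LHS](sum_eq1 (fun y => nat_of_bool (e x y)) w).
  by apply: eq_bigr => y _; rewrite mulnC.
by apply: (can_inj oddb); rewrite !nbrs // u2E.
Qed.

(** In-degree 2 makes [x] and [o x] share all out-neighbours, for every [x]. So [u] has arcs to both
    [c] and [o c], which have a common out-neighbour [w]. *)
Lemma no_outdeg2 (u : T) : False.
Proof.
have ireg v : indeg e v = 2 by rewrite -(aut_outdeg_indeg out injo aut u).
have swap x c : e x c -> o c != c /\ forall w, e x w = e (o x) w.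
  move=> exc; split; first exact: outlier_neq out c.
  have : 0 < #|[set v | e v c] :\ x|.
    have := ireg c; rewrite /indeg (cardsD1 x) inE exc; lia.
  move/card_gt0P => [v]; rewrite !inE eq_sym => /andP[nexv evc].
  by have [-> ] := outlier_swap nexv exc evc.
have out_nbr x : exists c, e x c.
  have : 0 < #|[set v | e x v]| by rewrite -/(outdeg e x) oreg.
  by move/card_gt0P => [c]; rewrite inE; exists c.
have [c euc] := out_nbr u; have [neoc nbrs] := swap u c euc.
have [w ecw] := out_nbr c; have [_ nbrs_c] := swap c w ecw.
case/eqP: neoc; apply/esym; apply: (outlier_step out (i := 1) (u := u) (v := w)) => //.
- by apply: ltnW.
- by rewrite nbrs aut.
- by rewrite nwalks1 ecw.
- by rewrite nwalks1 -nbrs_c ecw.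
Qed.

End OutDegreeTwo.

(** * Arithmetic *)

Lemma moore3 k : 2 * moore 3 k + 1 = 3 ^ k.+1.
Proof.
elim: k => [|k IHk]; first by rewrite /moore big_ord1.
by rewrite moore_pred expnS -IHk; lia.
Qed.

Lemma odd_moore3 k : odd (moore 3 k) = ~~ odd k.
Proof.
elim: k => [|k IHk]; first by rewrite /moore big_ord1.
by rewrite moore_pred oddD oddM IHk /= negbK.
Qed.

Lemma ltn_moore3 k : k < moore 3 k.
Proof.
elim: k => [|k IHk]; first by rewrite /moore big_ord1.
by rewrite moore_pred; lia.
Qed.

(** A product of primes that are all 1 mod c is itself 1 mod c. *)
Lemma exists_prime_neq1 c m : 0 < m -> m != 1 %[mod c] ->
  exists q, [/\ prime q, q %| m & q != 1 %[mod c]].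
Proof.
elim/ltn_ind: m => m IHm m0 neq1.
have m1 : 1 < m by rewrite ltn_neqAle m0 andbT; apply: contraNneq neq1 => <-.
have [q1 | ] := eqVneq (pdiv m %% c) (1 %% c); last first.
  by exists (pdiv m); rewrite pdiv_prime ?pdiv_dvd.
have [q [q_pr qm qc]] : exists q, [/\ prime q, q %| m %/ pdiv m & q != 1 %[mod c]].
  apply: IHm.
  - exact: ltn_Pdiv (prime_gt1 (pdiv_prime m1)) m0.
  - by rewrite divn_gt0 ?pdiv_gt0 // dvdn_leq ?pdiv_dvd.
  apply: contra neq1 => /eqP eq1.
  by rewrite -(divnK (pdiv_dvd m)) -modnMm eq1 q1 modnMm muln1.
exists q; split=> //; apply: dvdn_trans qm _.
by apply/dvdnP; exists (pdiv m); rewrite mulnC divnK ?pdiv_dvd.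
Qed.

Lemma dvdn_succ_exp x m : odd m -> x.+1 %| x ^ m + 1.
Proof.
move=> om; rewrite -(odd_double_half m) om add1n -mul2n.
elim: m./2 => [|h IHh]; first by rewrite muln0 expn1 addn1.
case: x IHh => [|x] IHh; first by rewrite dvd1n.
rewrite -(dvdn_addl _ (_ : x.+2 %| x.+1 ^ 2 - 1)); last first.
  by rewrite -[X in _ - X](exp1n 2) subn_sqr addn1 dvdn_mull.
have -> : x.+1 ^ (2 * h.+1).+1 + 1 + (x.+1 ^ 2 - 1) = x.+1 ^ 2 * (x.+1 ^ (2 * h).+1 + 1).
  have -> : (2 * h.+1).+1 = 2 + (2 * h).+1 by lia.
  by rewrite expnD; have : 0 < x.+1 ^ 2 by []; lia.
by rewrite dvdn_mull.
Qed.

(* For [k + 1 = 2^s * m] with [m > 1] odd, [3^(2^s) + 1] is a proper divisor of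
   [3^(k + 1) + 1 = 2 * (moore 3 k + 1)]. *)
Lemma prime_moore3_exp2 k : prime (moore 3 k + 1) -> exists s, k.+1 = 2 ^ s.
Proof.
move=> n_pr.
have [m + kE] := pfactor_coprime (isT : prime 2) (ltn0Sn k).
rewrite coprime2n => om; exists (logn 2 k.+1); rewrite {1}kE.
have [-> | m1] := eqVneq m 1; first by rewrite mul1n.
set x := 3 ^ 2 ^ logn 2 k.+1.
have xm : 2 * (moore 3 k + 1) = x ^ m + 1.
  by rewrite /x -expnM [2 ^ _ * m]mulnC -kE -moore3; lia.
have x3 : 3 <= x by rewrite /x -{1}(expn1 3) leq_exp2l // expn_gt0.
have ox : odd x by rewrite /x oddX orbT.
have := dvdn_succ_exp x om; rewrite -xm -(odd_double_half x.+1) /= ox add0n -mul2n.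
rewrite dvdn_pmul2l // => /(primeP n_pr).2.
have xE := odd_double_half x; rewrite ox in xE.
case/orP => /eqP half; first by lia.
suff : x < x ^ m by lia.
rewrite -{1}(expn1 x) ltn_exp2l; last lia.
by case: m om m1 {kE xm} => [|[]].
Qed.

Lemma expn_gcd_mod x a b q :
  0 < a -> x ^ a = 1 %[mod q] -> x ^ b = 1 %[mod q] -> x ^ gcdn a b = 1 %[mod q].
Proof.
move=> a0 xa xb; have [c _ /dvdnP[d dE]] := Bezoutl b a0.
have exp1 y e : y = 1 %[mod q] -> y ^ e = 1 %[mod q].
  by move=> y1; rewrite -modnXm y1 modnXm exp1n.
have : x ^ (gcdn a b + c * b) = 1 %[mod q] by rewrite dE mulnC expnM exp1.
by rewrite expnD [c * b]mulnC expnM -modnMmr (exp1 _ c xb) modnMmr muln1.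
Qed.

Section Arithmetic.

Variables (k t : nat).
Hypotheses (t0 : 0 < t) (kE : k.+1 = 2 ^ (2 * t)).

Lemma exp4_mod3 : k.+1 = 1 %[mod 3].
Proof. by rewrite kE expnM -modnXm exp1n. Qed.

Lemma odd_k : odd k.
Proof.
move: (congr1 odd kE); rewrite oddX /=; have -> : (2 * t == 0) = false by lia.
exact: negbFE.
Qed.

(** As k is odd, 2k + 1 has a prime factor q = 3 mod 4, and q is not 3 because 3 divides k. Then
    3^(k+1) = 1 and Fermat give 3^2 = 1 mod q, since k + 1 is a power of 2 and q - 1 is twice an odd
    number; but q does not divide 8. *)
Lemma irregular_arith : ~ 2 * k + 1 %| 3 ^ k * (3 ^ k.+1 - 1).
Proof.
have := exp4_mod3; have := odd_k => ok k3 dvd.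
have [q [q_pr qk q4]] : exists q, [/\ prime q, q %| 2 * k + 1 & q != 1 %[mod 4]].
  apply: exists_prime_neq1; first lia.
  by have := odd_double_half k; rewrite ok; lia.
have q2 : q != 2 by apply: contraTneq qk => ->; rewrite dvdn2 addn1 /= mul2n odd_double.
have q3 : q != 3 by apply: contraTneq qk => ->; lia.
have oq : odd q by case: (even_prime q_pr) q2 => [->|].
have gcd2 : gcdn k.+1 q.-1 = 2.
  have -> : k.+1 = 2 * 2 ^ (2 * t).-1.
    by rewrite kE -{1}(prednK (_ : 0 < 2 * t)) ?expnS // muln_gt0.
  have q4' : q %% 4 = 3 by move: q4 oq; clear; lia.
  have -> : q.-1 = 2 * q./2 by move: oq; clear; lia.
  rewrite -muln_gcdr; suff /eqP -> : coprime (2 ^ (2 * t).-1) q./2 by [].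
  by apply: coprimeXl; rewrite coprime2n; move: q4'; clear; lia.
have coq3 : coprime q 3 by rewrite prime_coprime // dvdn_prime2.
have : q %| 3 ^ k.+1 - 1.
  by have := dvdn_trans qk dvd; rewrite Gauss_dvdr // coprimeXr.
rewrite -eqn_mod_dvd ?expn_gt0 // => /eqP pow1.
have pow2 : 3 ^ q.-1 = 1 %[mod q].
  apply/eqP; rewrite eqn_mod_dvd ?expn_gt0 // -(Gauss_dvdr _ coq3) mulnBr muln1 -expnS.
  rewrite (prednK (prime_gt0 q_pr)) -eqn_mod_dvd; first exact/eqP/fermat_little.
  by rewrite -{1}(expn1 3) leq_exp2l // prime_gt0.
have := expn_gcd_mod _ pow1 pow2; rewrite gcd2.
move/(_ isT)/eqP; rewrite eqn_mod_dvd // -[_ - 1]/(2 ^ 3) Euclid_dvdX // dvdn_prime2 //.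
by rewrite (negPf q2).
Qed.

(* If [q = 2 mod 3] divides [k + 2], then [-1 = k + 1] and [3 = 3^(k+1)] would be
   squares mod [q], hence so would [-3], and [F_q] would contain a primitive
   third root of unity. *)
Lemma fixed_arith : ~ k + 2 %| moore 3 k - 1.
Proof.
have := exp4_mod3; have := odd_k => ok k3 dvd.
have [q [q_pr qk q1]] : exists q, [/\ prime q, q %| k + 2 & q != 1 %[mod 3]].
  by apply: exists_prime_neq1; lia.
have q2 : q != 2 by apply: contraTneq qk => ->; rewrite dvdn2 addn2 /= ok.
have q3 : q != 3 by apply: contraTneq qk => ->; lia.
have coq a : prime a -> q != a -> coprime q a.
  by move=> a_pr qa; rewrite prime_coprime // dvdn_prime2.
have qE : q = 3 * (q %/ 3) + 2.
  have : ~~ (3 %| q) by rewrite dvdn_prime2 // eq_sym.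
  by move: q1; clear; lia.
have k1 : 0 < k by case: (k) ok.
have pow3 : q %| 3 ^ k.+1 - 3.
  apply: dvdn_trans qk _; have -> : 3 ^ k.+1 - 3 = 2 * (moore 3 k - 1).
    by rewrite -moore3; clear; lia.
  by rewrite dvdn_mull.
(* A square root of (k + 1) * 3^(k+1), which is -3 mod [q]. *)
pose y := 2 ^ t * 3 ^ 2 ^ (2 * t).-1.
have y2 : q %| y ^ 2 + 3.
  have y2E : y ^ 2 = k.+1 * 3 ^ k.+1.
    rewrite /y expnMn -!expnM mulnC [t * 2]mulnC -kE mulnC -expnSr prednK ?muln_gt0 ?t0 //.
    by rewrite kE.
  have le3 : 3 <= 3 ^ k.+1 by rewrite -{1}(expn1 3) leq_exp2l.
  rewrite -(dvdn_addl _ pow3); have -> : y ^ 2 + 3 + (3 ^ k.+1 - 3) = (k + 2) * 3 ^ k.+1.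
    by rewrite y2E; move: (3 ^ k.+1) le3; clear; lia.
  by rewrite dvdn_mulr.
have y0 : 0 < y by rewrite muln_gt0 !expn_gt0.
(* With y^2 = -3, w/2 = (y - 1)/2 is a primitive cube root of unity, hence [w ^ 3 = 8]. *)
pose w := y.-1.
have quad : q %| w ^ 2 + 2 * w + 4.
  have -> : w ^ 2 + 2 * w + 4 = y ^ 2 + 3 by rewrite /w; case: (y) y0 => // ?; clear; nia.
  by [].
have cube : w ^ 3 = 8 %[mod q].
  have : w ^ 3 + 2 * (w ^ 2 + 2 * w + 4) = w * (w ^ 2 + 2 * w + 4) + 8 by clear; nia.
  move/(congr1 (modn^~ q)); case/dvdnP: quad => c ->.
  by rewrite !mulnA modnMDl addnC modnMDl.
(* Since q = 2 mod 3, cubes determine their roots. Comparing [w] with 2 gives 4w = 2w^2, hence w =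
   -1 and q divides 3. *)
have fermat x : (x ^ 3) ^ (q %/ 3) * x ^ 2 = x %[mod q].
  by rewrite -expnM -expnD -qE fermat_little.
have two : 8 ^ (q %/ 3) * 4 = 2 %[mod q] := fermat 2.
have fermat_w : 8 ^ (q %/ 3) * w ^ 2 = w %[mod q].
  by rewrite -modnMml -modnXm -cube modnXm modnMml fermat.
have w2 : 4 * w = 2 * w ^ 2 %[mod q].
  by rewrite -modnMmr -fermat_w modnMmr mulnA [4 * _]mulnC -modnMml two modnMml.
have : q %| 2 * w ^ 2 + (4 * w + 8).
  have -> : 2 * w ^ 2 + (4 * w + 8) = 2 * (w ^ 2 + 2 * w + 4) by clear; lia.
  by rewrite dvdn_mull.
rewrite /dvdn -modnDml -w2 modnDml -/(dvdn _ _).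
have -> : 4 * w + (4 * w + 8) = 2 ^ 3 * w.+1 by clear; lia.
rewrite Gauss_dvdr ?coprimeXr ?coq // => w1.
have : q %| w.+1 ^ 2 + 3.
  by have -> : w.+1 ^ 2 + 3 = w ^ 2 + 2 * w + 4 by clear; nia.
rewrite dvdn_addr; last by rewrite expnS dvdn_mulr.
by rewrite dvdn_prime2 // (negPf q3).
Qed.

End Arithmetic.

Lemma exp2_mod3 s : 2 ^ s %% 3 = if odd s then 2 else 1.
Proof. by elim: s => // s IHs; rewrite expnS -modnMmr IHs /=; case: (odd s). Qed.

(** * Degree three *)

Section DegreeThree.

Variables (T : finType) (e : rel T) (k : nat) (o : T -> T).
Hypotheses (out : outlier e k o) (injo : injective o).
Hypothesis aut : forall u v, e (o u) (o v) = e u v.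

Lemma order_neq1 x : order o x != 1.
Proof.
apply/eqP => ord1; have := iter_order injo x.
by rewrite ord1 /= => /eqP; rewrite (negPf (outlier_neq out x)).
Qed.

Lemma moore_deg0 : moore 0 k = 1.
Proof. by rewrite /moore big_ord_recl big1 // => i _; rewrite exp0n. Qed.

Lemma moore_deg1 : moore 1 k = k.+1.
Proof. by rewrite /moore; under eq_bigr do rewrite exp1n; rewrite sum1_card card_ord. Qed.

(** The vertices fixed by [iter (order o x) o] include [x] and form a regular digraph of degree at
    most 3. Degrees 0, 1 and 3 give the three alternatives; in degree 3 its order is that of the
    whole digraph. *)
Lemma fixed_order_cases x : 2 < k -> (forall u, outdeg e u = 3) ->
  [\/ #|[set y | iter (order o x) o y == y]| = 2 /\ order o x = 2,
      #|[set y | iter (order o x) o y == y]| = k.+2 /\ order o x = k.+2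
    | forall y, order o y %| order o x].
Proof.
move=> k2 oreg; set r := order o x; rewrite card_fixed.
have fx : x \in [pred y | iter r o y == y] by rewrite inE iter_order.
pose a : fixed o r := exist _ x fx.
have fout := fixed_is_outlier out injo aut (r := r).
have finj : injective (@fixed_outlier T o r) by apply: fixed_outlier_inj.
have faut := fixed_aut aut (r := r).
pose d := outdeg (@fixed_rel T e o r) a.
have freg b : outdeg (@fixed_rel T e o r) b = d.
  by rewrite (aut_outdeg_indeg fout finj faut b a) -(aut_outdeg_indeg fout finj faut a a).
have card_fix := outlier_card fout a freg.
have ord_a : order (@fixed_outlier T o r) a = r.
  apply/eqP; rewrite eqn_dvd (order_dvdn finj) -(inj_eq val_inj) val_iter_fixed /=.
  rewrite /r iter_order // eqxx /= (order_dvdn injo).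
  by have := congr1 val (iter_order finj a); rewrite val_iter_fixed /= => ->.
have : d <= 3 by rewrite -(oreg x); apply: outdeg_fixed.
case: d freg card_fix => [|[|[|[|d]]]] // freg card_fix _.
- apply: Or31; rewrite card_fix moore_deg0; split=> //.
  have : order (@fixed_outlier T o r) a <= #|{: fixed o r}| := max_card _.
  rewrite ord_a card_fix moore_deg0.
  by have := order_neq1 x; have := order_gt0 o x; rewrite -/r; lia.
- apply: Or32; rewrite card_fix moore_deg1 addn1; split=> //.
  by rewrite -[LHS]ord_a; apply: (outdeg1_order fout finj faut) => //; lia.
- by case: (no_outdeg2 fout finj faut k2 freg a).
- apply: Or33 => y.
  have : y \in [set y | iter r o y == y].
    suff /eqP -> : [set y | iter r o y == y] == setT by rewrite inE.
    by rewrite eqEcard subsetT cardsT card_fixed card_fix (outlier_card out x oreg) leqnn.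
  by rewrite inE order_dvdn.
Qed.

(** If the powers of [o] act transitively, write c = o^i z and b = o^j z; then o^(i+j) z is an
    out-neighbour of both [b] and [c]. *)
Lemma not_circulant z c : 1 < k -> order o z = #|T| -> e z c -> outdeg e z <= 1.
Proof.
move=> k1 ord_z ezc.
have conn y : fconnect o z y by have := subset_cardP ord_z (subset_predT _) y.
rewrite -(cards1 c); apply/subset_leq_card/subsetP => b; rewrite !inE => ezb.
have cE := iter_findex (conn c); have bE := iter_findex (conn b).
apply/eqP; pose v := iter (findex o z b + findex o z c) o z.
apply: (outlier_step out k1 ezb ezc (v := v)); rewrite /v.
  by rewrite nwalks1 iterD cE -{1}bE aut_iter ?ezc.
by rewrite addnC nwalks1 iterD bE -{1}cE aut_iter ?ezb.
Qed.

Lemma no_regular_degree3 (x : T) : 2 < k -> odd k -> (forall u, outdeg e u = 3) ->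
  prime #|T| -> odd #|T| -> k + 4 < #|T| -> k + 2 %| #|T| - 2.
Proof.
move=> k2 ok oreg T_pr oT ltT.
pose Fix r := [set y | iter r o y == y].
have FixP r y : (y \in Fix r) = (order o y %| r) by rewrite inE order_dvdn.
have cases y := fixed_order_cases y k2 oreg.
(* Otherwise every vertex lies in a fixed set of size 2 or k + 2, leaving at most k + 4 vertices. *)
have [z top] : exists z, forall y, order o y %| order o z.
  suff : [exists z, [forall y, order o y %| order o z]].
    by case/existsP => z /forallP; exists z.
  apply: contraT; rewrite negb_exists => /forallP ntop.
  have small2 : #|if #|Fix 2| == 2 then Fix 2 else set0| <= 2.
    by case: eqP => [->|]; rewrite ?cards0.
  have smallk : #|if #|Fix k.+2| == k.+2 then Fix k.+2 else set0| <= k.+2.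
    by case: eqP => [->|]; rewrite ?cards0.
  suff /subset_leq_card : [set: T] \subset (if #|Fix 2| == 2 then Fix 2 else set0) :|:
      (if #|Fix k.+2| == k.+2 then Fix k.+2 else set0).
    rewrite cardsT => leT; have := leq_trans leT (leq_card_setU _ _).
    lia.
  apply/subsetP => y _; rewrite inE.
  case: (cases y) => [[c2 ord2]|[ck ordk]|all_dvd].
  - by rewrite -{1}ord2 -/(Fix _) c2 eqxx FixP ord2 dvdnn.
  - by apply/orP; right; rewrite -{1}ordk -/(Fix _) ck eqxx FixP ordk dvdnn.
  - by have /forallP := ntop y; case.
set L := order o z; pose Y := [set y | order o y == L].
have Lmax y : (forall x, order o x %| order o y) -> y \in Y.
  by move=> all_dvd; rewrite inE eqn_dvd top all_dvd.
have LY : L %| #|Y|.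
  apply: (dvdn_card_order injo) => [u v /eqP <- | u]; last by rewrite inE => /eqP.
  by rewrite !inE order_f.
have cardT : #|T| = #|Y| + #|~: Y| by rewrite cardsC.
have Lneq1 : L != 1 := order_neq1 z.
pose small r := [exists u, (u \notin Y) && (order o u == r)].
have fix_small r : r \in [:: 2; k.+2] -> small r ->
    [/\ #|Fix r| = r, r %| L & Fix r \subset ~: Y].
  move=> r_eq /existsP[u /andP[uY /eqP ord_u]].
  have rL : r %| L by rewrite -ord_u.
  split=> //.
    rewrite -ord_u; case: (cases u) => [[cF ordE]|[cF ordE]|/Lmax].
    - by rewrite [RHS]ordE.
    - by rewrite [RHS]ordE.
    - by rewrite (negPf uY).
  apply/subsetP => y; rewrite FixP !inE => ord_y; apply: contra uY => /eqP yL.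
  by rewrite inE ord_u eqn_dvd rL -yL.
have smallP u : u \notin Y -> order o u = 2 /\ small 2 \/ order o u = k.+2 /\ small k.+2.
  move=> uY; case: (cases u) => [[_ ord_u]|[_ ord_u]|/Lmax]; last by rewrite (negPf uY).
    by left; split=> //; apply/existsP; exists u; rewrite uY ord_u /=.
  by right; split=> //; apply/existsP; exists u; rewrite uY ord_u /=.
pose F r := if small r then Fix r else set0.
have F_card r : r \in [:: 2; k.+2] -> #|F r| = if small r then r else 0.
  by move=> r_eq; rewrite /F; case: ifP => [/(fix_small _ r_eq)[]|]; rewrite ?cards0.
have compl : ~: Y = F 2 :|: F k.+2.
  apply/eqP; rewrite eqEsubset; apply/andP; split.
    apply/subsetP => u; rewrite in_setC in_setU => /smallP[] [ord_u sm]; rewrite /F sm.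
      by rewrite FixP ord_u dvdnn.
    by rewrite FixP ord_u dvdnn orbT.
  have subF r : r \in [:: 2; k.+2] -> F r \subset ~: Y.
    by move=> r_eq; rewrite /F; case: ifP => [/(fix_small _ r_eq)[]|]; rewrite ?sub0set.
  by rewrite subUset !subF // !inE eqxx ?orbT.
(* A common vertex would have order dividing gcd(2, k + 2) = 1, as k is odd. *)
have disj : F 2 :&: F k.+2 = set0.
  apply/eqP; rewrite -subset0; apply/subsetP => u; rewrite in_setI /F.
  case: (small 2) (small k.+2) => [] []; rewrite ?in_set0 ?andbF //.
  rewrite !FixP => /andP[ord2 ordk].
  have : order o u %| gcdn 2 k.+2 by rewrite dvdn_gcd ord2.
  have /eqP -> : coprime 2 k.+2 by rewrite coprime2n /= ok.
  by rewrite dvdn1 (negPf (order_neq1 u)).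
have cardF : #|~: Y| = #|F 2| + #|F k.+2| by rewrite compl cardsU disj cards0 subn0.
have cardTE : #|T| = #|Y| + ((if small 2 then 2 else 0) + if small k.+2 then k.+2 else 0).
  by rewrite cardT cardF !F_card ?inE ?eqxx ?orbT.
move: cardTE T_pr oT ltT => ->.
(* Each short orbit length present divides [L], hence [#|Y|]. The cases are: both present, only 2,
   only k + 2, none. *)
have [sm2 | no2] := boolP (small 2); have [smk | nok] := boolP (small k.+2) => T_pr oT ltT.
- have [_ kL _] := fix_small _ (mem_last 2 [:: k.+2]) smk.
  have -> : #|Y| + (2 + k.+2) - 2 = #|Y| + k.+2 by lia.
  by rewrite addn2 dvdn_add // (dvdn_trans kL LY).
- have [_ L2 _] := fix_small _ (mem_head 2 [:: k.+2]) sm2.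
  have := dvdn_trans L2 LY; rewrite dvdn2 => /negPf Yeven.
  by rewrite addn0 oddD Yeven in oT.
- have [_ kL _] := fix_small _ (mem_last 2 [:: k.+2]) smk.
  have : k.+2 %| #|Y| + (0 + k.+2) by rewrite add0n dvdn_add // (dvdn_trans kL LY).
  by move/(primeP T_pr).2 => /orP[] /eqP; lia.
have YT : #|T| = #|Y|.
  by rewrite cardT cardF !F_card ?inE ?eqxx ?orbT // (negPf no2) (negPf nok) !addn0.
have LT : L = #|T|.
  have := (primeP T_pr).2 L; rewrite !addn0 => /(_ LY).
  by rewrite (negPf Lneq1) YT => /eqP.
have [c ezc] : exists c, e z c.
  have : 0 < #|[set v | e z v]| by rewrite -/(outdeg e z) oreg.
  by move/card_gt0P => [c]; rewrite inE; exists c.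
by have := not_circulant (ltnW k2) LT ezc; rewrite oreg.
Qed.

End DegreeThree.

(** * Combination of the irregular and the diregular case *)

Theorem corollary11 (k : nat) (hk : 2 <= k)
  (hmod : k = 3 %[mod 6] \/ k = 5 %[mod 6])
  (hdiv : ~~ (k + 2 %| (moore 3 k - k - 1) %/ 2))
  (hprime : prime (moore 3 k + 1)) :
  ~ (exists (T : finType) (e : rel T), excess_one_digraph 3 k e).
Proof.
case=> T [e exc].
have [s kE] := prime_moore3_exp2 hprime.
(* k = 5 mod 6 would make 3 divide the power of 2 [k.+1]. *)
have k_mod6 : k %% 6 = 3.
  have := exp2_mod3 s; rewrite -kE; case: (odd s); lia.
have es : ~~ odd s.
  have := exp2_mod3 s; rewrite -kE; case: (odd s); lia.
have sE : s = 2 * s./2 by have := odd_double_half s; rewrite (negPf es); lia.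
have t0 : 0 < s./2.
  by have := odd_double_half s; case: s./2 sE kE => // ->; rewrite expn0; lia.
rewrite sE in kE.
have ok := odd_k t0 kE.
have k2 : 2 < k by lia.
have [o out] := excess_one_outlier hk (isT : 1 < 3) exc.
have oreg := excess_one_outregular hk (isT : 1 < 3) exc.
have [_ [_ [x _]] cardT] := exc.
have [/existsP[v lt_v] | ] := boolP [exists v, 3 < indeg e v].
  exact: irregular_arith t0 kE (irregular_dvdn out oreg hk lt_v).
rewrite negb_exists => /forallP le3.
have ireg v : indeg e v = 3.
  by apply: (indeg_excess oreg) => w; rewrite leqNgt.
have injo := regular_outlier_inj out oreg ireg.
have aut := regular_outlier_aut out oreg ireg.
have ltk : k + 3 < moore 3 k.
  case: (k) k2 => // j j2; have := ltn_moore3 j; rewrite moore_pred; lia.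
have := no_regular_degree3 out injo aut x k2 ok oreg; rewrite cardT.
move/(_ hprime); rewrite oddD odd_moore3 ok => /(_ isT).
have -> : moore 3 k + 1 - 2 = moore 3 k - 1 by lia.
move=> dvd; apply: (fixed_arith t0 kE); apply: dvd; lia.
Qed.
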